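(* Let $q$ be a power of $2$ and $h>1$. (i) Let $\mathcal{B}$ be an elation KM-arc of type $t>2$ in $\mathrm{PG}(2,q)$ with elation line $X=0$ and $t$-nucleus $(0,0,1)$, and let $\mathcal{A}$ be a KM-arc in $\mathrm{PG}(2,q^h)$ that arises from $\mathcal{B}$ by Construction (C). Then $\mathcal{A}$ is an elation KM-arc with elation line $X=0$ and $tq^{h-1}$-nucleus $(0,0,1)$. (ii) Let $\mathcal{H}$ be a hyperoval in $\mathrm{PG}(2,q)$ that is stabilised by a non-trivial elation with axis $X=0$ and centre $(0,0,1)$, and let $\mathcal{A}'$ be a KM-arc in $\mathrm{PG}(2,q^h)$ that arises from $\mathcal{H}$ by Construction (B). Then $\mathcal{A}'$ is an elation KM-arc with elation line $X=0$ and $2q^{h-1}$-nucleus $(0,0,1)$.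
   Context: Points have homogeneous coordinates $(X,Y,Z)$; affine points are those not on $X=0$. A KM-arc of type $t$ in $\mathrm{PG}(2,q)$ is a set of $q+t$ points such that every line meets it in $0$, $2$ or $t$ points (each value occurring); a line meeting it in $i$ points is an $i$-secant. A hyperoval is a KM-arc of type $2$. If $t>2$, all $t$-secants pass through one common point, the $t$-nucleus. Constructions (B) and (C) (Gács–Weiner). Let $I$ be a direct complement of $\mathbb{F}_q$ in the additive group of $\mathbb{F}_{q^h}$, $h>1$, and let $H$ be a KM-arc (possibly a hyperoval) in $\mathrm{PG}(2,q)$ with affine part $\{(1,x_k,y_k)\}$. Put $J=\{(1,x_k,y_k+i)\mid (1,x_k,y_k)\in H,\ i\in I\}\subset\mathrm{PG}(2,q^h)$. (B) If $H$ is a hyperoval and $(0,0,1)\notin H$, then $J$ extends uniquely (by points on $X=0$, possibly none) to a KM-arc of type $2q^{h-1}$ in $\mathrm{PG}(2,q^h)$, with $2q^{h-1}$-nucleus $(0,0,1)$. (C) If $H$ is a KM-arc of type $t>2$ with $t$-nucleus $(0,0,1)$, then $J$ extends uniquely (by points on $X=0$, possibly none) to a KM-arc of type $tq^{h-1}$ in $\mathrm{PG}(2,q^h)$, with $tq^{h-1}$-nucleus $(0,0,1)$. The resulting KM-arc is said to arise from $H$ by Construction (B), resp. (C). An elation with axis a line $\ell$ and centre a point $R\in\ell$ is a collineation fixing all points of $\ell$ and stabilising all lines through $R$. A KM-arc $\mathcal{A}$ of type $t>2$ is an elation KM-arc with elation line $\ell_\infty$ if for every $t$-secant $\ell\neq\ell_\infty$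 the group of elations with axis $\ell_\infty$ stabilising $\mathcal{A}$ is transitive on the points of $\mathcal{A}\cap\ell$ (any point of $\mathcal{A}\cap\ell$ can be mapped to any other one by an element of the group). *)

(* Defs.v *)
From HB Require Import structures.
From mathcomp Require Import all_boot all_order all_fingroup all_algebra.

Set Implicit Arguments.
Unset Strict Implicit.
Unset Printing Implicit Defensive.
Import GRing.Theory.
Local Open Scope ring_scope.

(* Makes the subType structure of {vspace vT} canonical. *)
Import VectorInternalTheory.

HB.instance Definition _ (F : finFieldType) (vT : vectType F) :=
  [Countable of {vspace vT} by <:].
HB.instance Definition _ (F : finFieldType) (vT : vectType F) :=
  [Finite of {vspace vT} by <:].

(* The points and lines of PG(2,q), q = #|F|, are the subspaces of F^3 of
   dimension 1 and 2. *)
Definition point (F : finFieldType) := {P : {vspace 'rV[F]_3} | \dim P == 1%N}.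
Definition line (F : finFieldType) := {l : {vspace 'rV[F]_3} | \dim l == 2%N}.

Definition incident (F : finFieldType) (P : point F) (l : line F) : bool :=
  (val P <= val l)%VS.

Definition points_on (F : finFieldType) (l : line F) : {set point F} :=
  [set P | incident P l].

Definition hvec (F : finFieldType) (x y z : F) : 'rV[F]_3 :=
  \row_(j < 3) [:: x; y; z]`_j.

Lemma hpoint_subproof (F : finFieldType) (v : 'rV[F]_3) :
  v != 0 -> \dim <[v]> == 1%N.
Proof. by move=> v0; rewrite dim_vline v0. Qed.

Definition hpoint (F : finFieldType) (v : 'rV[F]_3) (v0 : v != 0) : point F :=
  exist _ <[v]>%VS (hpoint_subproof v0).

Lemma hvec1_neq0 (F : finFieldType) (x y : F) : hvec 1 x y != 0.
Proof.
by apply/eqP=> /rowP/(_ 0)/eqP; rewrite !mxE /= oner_eq0.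
Qed.

Lemma hvec001_neq0 (F : finFieldType) : hvec 0 0 (1 : F) != 0.
Proof.
by apply/eqP=> /rowP/(_ (Ordinal (isT : 2 < 3)%N))/eqP; rewrite !mxE /= oner_eq0.
Qed.

Definition affpt (F : finFieldType) (x y : F) : point F :=
  hpoint (hvec1_neq0 x y).

Definition pt001 (F : finFieldType) : point F := hpoint (hvec001_neq0 F).

Definition coordX (F : finFieldType) (v : 'rV[F]_3) : F^o := v 0 0.

Lemma coordX_linear (F : finFieldType) : linear (@coordX F).
Proof. by move=> a u v; rewrite /coordX !mxE. Qed.

HB.instance Definition _ (F : finFieldType) :=
  GRing.isLinear.Build F 'rV[F]_3 F^o _ (@coordX F) (@coordX_linear F).

Lemma lineX0_subproof (F : finFieldType) :
  \dim (lker (linfun (@coordX F))) == 2%N.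
Proof.
have := limg_ker_dim (linfun (@coordX F)) fullv.
rewrite capfv dimvf /dim /= mul1n.
suff -> : limg (linfun (@coordX F)) = fullv.
  by rewrite dimvf /dim /= addn1 => -[->].
apply/vspaceP=> a; rewrite memvf; apply/memv_imgP.
by exists (hvec a 0 0); rewrite ?memvf // lfunE /= /coordX mxE.
Qed.

Definition lineX0 (F : finFieldType) : line F :=
  exist _ (lker (linfun (@coordX F))) (lineX0_subproof F).

Lemma mem_lineX0 (F : finFieldType) (v : 'rV[F]_3) :
  (v \in val (lineX0 F)) = (v 0 0 == 0).
Proof. by rewrite memv_ker lfunE. Qed.

Definition secant (F : finFieldType) (i : nat) (A : {set point F})
  (l : line F) : bool := #|A :&: points_on l| == i.

Definition KM_arc (F : finFieldType) (t : nat) (A : {set point F}) : Prop :=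
  [/\ #|A| = (#|F| + t)%N,
      forall l, [|| secant 0 A l, secant 2 A l | secant t A l],
      exists l, secant 0 A l,
      exists l, secant 2 A l
    & exists l, secant t A l].

Definition hyperoval (F : finFieldType) (H : {set point F}) : Prop :=
  KM_arc 2 H.

(* N is the t-nucleus of the KM-arc A of type t > 2. *)
Definition nucleus (F : finFieldType) (t : nat) (A : {set point F})
  (N : point F) : Prop :=
  forall l, secant t A l -> incident N l.

Definition collineation (F : finFieldType) (phi : {perm point F}) : Prop :=
  forall l, exists m, phi @: points_on l = points_on m.

Definition elation (F : finFieldType) (l : line F) (R : point F)
  (phi : {perm point F}) : Prop :=
  [/\ collineation phi,
      incident R l,
      forall P, incident P l -> phi P = P
    & forall m, incident R m -> phi @: points_on m = points_on m].

Definition stabilises (F : finFieldType) (phi : {perm point F})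
  (A : {set point F}) : Prop := phi @: A = A.

(* The elations with axis linf and arbitrary centre on linf form a group; the
   last clause is the transitivity of the stabiliser of A in this group. *)
Definition elation_KM_arc (F : finFieldType) (t : nat) (A : {set point F})
  (linf : line F) : Prop :=
  [/\ (2 < t)%N, KM_arc t A
    & forall l, secant t A l -> l != linf ->
      forall P Q, P \in A :&: points_on l -> Q \in A :&: points_on l ->
      exists phi : {perm point F},
        [/\ exists R, elation linf R phi, stabilises phi A & phi P = Q]].

(* I is a direct complement of the image of F in the additive group of L. *)
Definition direct_complement (F L : finFieldType) (iota : {rmorphism F -> L})
  (I : {set L}) : Prop :=
  [/\ zmod_closed I,
      forall a, iota a \in I -> iota a = 0
    & forall z, exists a, exists2 i, i \in I & z = iota a + i].

(* J, with F identified with its image under iota. *)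
Definition Jset (F L : finFieldType) (iota : {rmorphism F -> L})
  (I : {set L}) (H : {set point F}) : {set point L} :=
  [set P | [exists x, exists y, exists i,
     [&& affpt x y \in H, i \in I & P == affpt (iota x) (iota y + i)]]].

Definition extendsX0 (L : finFieldType) (J A : {set point L}) : Prop :=
  J \subset A /\ A :\: J \subset points_on (lineX0 L).

(* By Gacs and Weiner, J has a unique extension A of this kind; in both
   constructions the nucleus of A is a consequence, not a requirement.
   Here #|L| = #|F| ^ h, so h.-1 gives the exponent of q in the type of A. *)
Definition arises_by_B (F L : finFieldType) (iota : {rmorphism F -> L})
  (h : nat) (H : {set point F}) (A : {set point L}) : Prop :=
  [/\ hyperoval H, pt001 F \notin H
    & exists I, [/\ direct_complement iota I,
                    KM_arc (2 * #|F| ^ h.-1)%N A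
                  & extendsX0 (Jset iota I H) A]].

Definition arises_by_C (F L : finFieldType) (iota : {rmorphism F -> L})
  (h t : nat) (H : {set point F}) (A : {set point L}) : Prop :=
  [/\ (2 < t)%N, KM_arc t H, nucleus t H (pt001 F)
    & exists I, [/\ direct_complement iota I,
                    KM_arc (t * #|F| ^ h.-1)%N A
                  & extendsX0 (Jset iota I H) A]].

(* Main.v *)
(* An elation with axis X = 0 and centre (0,0,1) acts on the affine points as a
   translation (x, y) -> (x, y + c), so in both cases the affine part of the arc
   H over F_q is invariant under y -> y + (y2 - y1) whenever (x, y1) and (x, y2)
   lie in H, and every line through (0,0,1) and an affine point of H contains
   exactly t points of H (t = 2 for a hyperoval).  For such an H, if i1 and i2
   are in I, the translation of the affine plane over F_(q^h) by
   (y2 - y1) + (i2 - i1) preserves J, hence A, and sends (x, y1 + i1) to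
   (x, y2 + i2).  Counting A along the lines through one of its affine points
   shows that the secants of maximal size other than X = 0 are exactly the lines
   through (0,0,1) that meet J. *)

Require Import Defs.
From HB Require Import structures.
From mathcomp Require Import all_boot all_order all_fingroup all_algebra.
From mathcomp Require Import ring zify.

Set Implicit Arguments.
Unset Strict Implicit.
Unset Printing Implicit Defensive.
Import GRing.Theory.
Local Open Scope ring_scope.

(** * Lines of the plane as kernels of linear forms *)

Definition form (F : finFieldType) (a b c : F) (v : 'rV[F]_3) : F^o :=
  a * v 0 0 + b * v 0 1 + c * v 0 2%:R.

Lemma form_linear (F : finFieldType) (a b c : F) : linear (form a b c).
Proof. by move=> k u v; rewrite /form !mxE /GRing.scale /=; ring. Qed.

HB.instance Definition _ (F : finFieldType) (a b c : F) :=
  GRing.isLinear.Build F 'rV[F]_3 F^o _ (form a b c) (form_linear a b c).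

Lemma form_hvec (F : finFieldType) (a b c x y z : F) :
  form a b c (hvec x y z) = a * x + b * y + c * z.
Proof. by rewrite /form !mxE. Qed.

(** Rank-nullity: dividing by a non-zero coefficient shows that the form is onto, so its kernel has
    dimension 3 - 1. *)
Lemma dim_ker_form (F : finFieldType) (a b c : F) :
  [|| a != 0, b != 0 | c != 0] -> \dim (lker (linfun (form a b c))) == 2%N.
Proof.
move=> nz; have := limg_ker_dim (linfun (form a b c)) fullv.
rewrite capfv dimvf /dim /= mul1n.
suff -> : limg (linfun (form a b c)) = fullv.
  by rewrite dimvf /dim /= addn1 => -[->].
apply/vspaceP=> k; rewrite memvf; apply/memv_imgP.
case/or3P: nz => nz; [exists (hvec (k / a) 0 0) | exists (hvec 0 (k / b) 0)
  | exists (hvec 0 0 (k / c))];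
  by rewrite ?memvf // lfunE /= form_hvec; field.
Qed.

Lemma dim_vline_form (F : finFieldType) (x : F) :
  \dim (lker (linfun (form (- x) 1 0))) == 2%N.
Proof. by apply: dim_ker_form; rewrite oner_eq0 orbT. Qed.

Lemma dim_sline_form (F : finFieldType) (m b : F) :
  \dim (lker (linfun (form b m (-1)))) == 2%N.
Proof. by apply: dim_ker_form; rewrite oppr_eq0 oner_eq0 !orbT. Qed.

(** Equation Y = x X: the affine points (1, x, y) with y free, completed by (0,0,1). *)
Definition vline (F : finFieldType) (x : F) : line F :=
  exist _ (lker (linfun (form (- x) 1 0))) (dim_vline_form x).

(** Equation Z = m Y + b X: the affine line y = m x + b of slope m, completed by [infpt m]. *)
Definition sline (F : finFieldType) (m b : F) : line F :=
  exist _ (lker (linfun (form b m (-1)))) (dim_sline_form m b).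

Lemma hvec01_neq0 (F : finFieldType) (m : F) : hvec 0 1 m != 0.
Proof. by apply/eqP=> /rowP/(_ 1)/eqP; rewrite !mxE /= oner_eq0. Qed.

Definition infpt (F : finFieldType) (m : F) : point F := hpoint (hvec01_neq0 m).

(** * Incidence between points and lines in coordinates *)

Section Plane.
Variable F : finFieldType.
Implicit Types (x y m b c : F) (P Q R : point F) (l : line F).
Implicit Types (A B : {set point F}).

Lemma affpt_vline x x' y : incident (affpt x' y) (vline x) = (x' == x).
Proof.
by rewrite /incident /= -memvE memv_ker lfunE /= form_hvec !mulr1 mul1r mul0r
  addr0 addrC subr_eq0.
Qed.

Lemma infpt_vline x m : incident (infpt m) (vline x) = false.
Proof.
rewrite /incident /= -memvE memv_ker lfunE /= form_hvec mulr0 mulr1 mul0r add0r.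
by rewrite addr0 oner_eq0.
Qed.

Lemma pt001_vline x : incident (pt001 F) (vline x).
Proof.
by rewrite /incident /= -memvE memv_ker lfunE /= form_hvec !mulr0 mul0r !addr0.
Qed.

Lemma affpt_sline m b x y : incident (affpt x y) (sline m b) = (y == m * x + b).
Proof.
rewrite /incident /= -memvE memv_ker lfunE /= form_hvec mulr1 mulN1r subr_eq0.
by rewrite addrC eq_sym.
Qed.

Lemma infpt_sline m b m' : incident (infpt m') (sline m b) = (m' == m).
Proof.
rewrite /incident /= -memvE memv_ker lfunE /= form_hvec mulr0 mulr1 add0r.
by rewrite mulN1r subr_eq0 eq_sym.
Qed.

Lemma pt001_sline m b : incident (pt001 F) (sline m b) = false.
Proof.
rewrite /incident /= -memvE memv_ker lfunE /= form_hvec !mulr0 !add0r mulr1.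
by rewrite oppr_eq0 oner_eq0.
Qed.

Lemma affpt_lineX0 x y : incident (affpt x y) (lineX0 F) = false.
Proof. by rewrite /incident /= -memvE mem_lineX0 mxE /= oner_eq0. Qed.

Lemma infpt_lineX0 m : incident (infpt m) (lineX0 F).
Proof. by rewrite /incident /= -memvE mem_lineX0 mxE. Qed.

Lemma pt001_lineX0 : incident (pt001 F) (lineX0 F).
Proof. by rewrite /incident /= -memvE mem_lineX0 mxE. Qed.

Lemma affpt_inj x y x' y' : affpt x y = affpt x' y' -> x = x' /\ y = y'.
Proof.
move=> e; split; apply/eqP.
  by rewrite -(affpt_vline x' x y) e affpt_vline.
by rewrite -[y']add0r -(mul0r x) -affpt_sline e affpt_sline mul0r add0r.
Qed.

Lemma hpoint_eq P (v : 'rV[F]_3) (v0 : v != 0) : v \in val P -> P = hpoint v0.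
Proof.
move=> vP; apply: val_inj; apply/esym/eqP; rewrite eqEdim -memvE vP /=.
by rewrite (eqP (valP P)) dim_vline v0.
Qed.

(** Rescale a spanning vector so that its first non-zero coordinate becomes 1. *)
Lemma point_cases P :
  [\/ exists x y, P = affpt x y, exists m, P = infpt m | P = pt001 F].
Proof.
set v := vpick (val P); have vP : v \in val P by exact: memv_pick.
have v0 : v != 0.
  by rewrite vpick0; apply/eqP => e; have := valP P; rewrite e dimv0.
have normal (k a b c : F) : v = k *: hvec a b c -> hvec a b c \in val P.
  move=> e; have k0 : k != 0 by apply: contraNneq v0 => k0; rewrite e k0 scale0r.
  by rewrite -[hvec a b c](scalerK k0) -e memvZ.
have row3 k a b c : v 0 0 = k * a -> v 0 1 = k * b -> v 0 2%:R = k * c ->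
    v = k *: hvec a b c.
  move=> ea eb ec; apply/rowP; case=> [[|[|[|//]]] lt]; rewrite !mxE /=;
    [rewrite -ea|rewrite -eb|rewrite -ec]; congr (v _ _); exact: val_inj.
have [v00|v00] := eqVneq (v 0 0) 0; last first.
  constructor 1; exists (v 0 1 / v 0 0), (v 0 2%:R / v 0 0).
  by apply/hpoint_eq/(@normal (v 0 0))/row3; field.
have [v01|v01] := eqVneq (v 0 1) 0; last first.
  constructor 2; exists (v 0 2%:R / v 0 1).
  by apply/hpoint_eq/(@normal (v 0 1))/row3; rewrite ?v00; field.
constructor 3; apply/hpoint_eq/(@normal (v 0 2%:R))/row3;
  by rewrite ?v00 ?v01; ring.
Qed.

(** Distinct points meet in 0, so their sum has dimension 2 and fills every line containing both. *)
Lemma line_eq P Q l l' : P != Q -> incident P l -> incident Q l ->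
  incident P l' -> incident Q l' -> l = l'.
Proof.
rewrite /incident => PQ Pl Ql Pl' Ql'.
have dPQ : \dim (val P + val Q)%VS = 2%N.
  have := dimv_sum_cap (val P) (val Q).
  suff -> : (val P :&: val Q)%VS = 0%VS.
    by rewrite dimv0 addn0 (eqP (valP P)) (eqP (valP Q)).
  apply: contraNeq PQ => /eqP ne0; apply/eqP/val_inj/eqP.
  rewrite eqEdim (eqP (valP P)) (eqP (valP Q)) andbT.
  suff /eqP <- : (val P :&: val Q)%VS == val P by exact: capvSr.
  by rewrite eqEdim capvSl (eqP (valP P)) lt0n dimv_eq0; apply/eqP.
have sum (k : line F) : (val P <= val k)%VS -> (val Q <= val k)%VS ->
    val k = (val P + val Q)%VS.
  move=> Pk Qk; apply/esym/eqP.
  by rewrite eqEdim dPQ (eqP (valP k)) subv_add Pk Qk.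
by apply: val_inj; rewrite (sum l) // (sum l').
Qed.

Lemma lines_meet l l' : exists P, incident P l && incident P l'.
Proof.
have := dimv_sum_cap (val l) (val l'); rewrite (eqP (valP l)) (eqP (valP l')).
have : (\dim (val l + val l') <= 3)%N.
  by apply: leq_trans (dimvS (subvf _)) _; rewrite dimvf /dim /=.
move=> le3 e4; have ne0 : vpick (val l :&: val l')%VS != 0.
  by rewrite vpick0 -dimv_eq0; lia.
exists (hpoint ne0); rewrite /incident /= -!memvE.
by have := memv_pick (val l :&: val l')%VS; rewrite memv_cap.
Qed.

(** The line is determined by the affine point and a point where it meets X = 0, which is (0,0,1) or
    some [infpt m]. *)
Lemma line_affpt_cases x y l : incident (affpt x y) l ->
  l = vline x \/ exists m, l = sline m (y - m * x).
Proof.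
move=> Pl; have [R /andP[Rl RX]] := lines_meet l (lineX0 F).
have PR : affpt x y != R.
  by apply/eqP => e; move: RX; rewrite -e affpt_lineX0.
have [[x' [y' e]]|[m e]|e] := point_cases R.
- by move: RX; rewrite e affpt_lineX0.
- right; exists m; apply: (line_eq PR) => //.
    by rewrite affpt_sline addrC subrK.
  by rewrite e infpt_sline.
- left; apply: (line_eq PR) => //; first by rewrite affpt_vline.
  by rewrite e pt001_vline.
Qed.

(** * Counting the points of an arc along pencils of lines *)

(** Each point of [A] off the vertical line through P = (1, x, y) lies on exactly one line through P
    with a slope. P itself is already counted on the vertical line, whence the predecessor in each
    term. *)
Lemma card_pencil A x y : affpt x y \in A ->
  #|A| = (#|A :&: points_on (vline x)| +
    \sum_(m : F) #|A :&: points_on (sline m (y - m * x)%R)|.-1)%N.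
Proof.
move=> PA; rewrite -(cardsID (points_on (vline x)) A); congr addn.
transitivity (\sum_(Q in A :\: points_on (vline x))
    \sum_(m | incident Q (sline m (y - m * x)%R)) 1)%N.
  rewrite -sum1_card; apply: eq_bigr => Q; rewrite !inE => /andP[Qv QA].
  suff [m Qm] : exists m, forall m',
      incident Q (sline m' (y - m' * x)) = (m' == m).
    by rewrite (eq_bigl _ _ Qm) big_pred1_eq.
  have [[x' [y' e]]|[m e]|e] := point_cases Q; subst Q.
  - rewrite affpt_vline -subr_eq0 in Qv.
    exists ((y' - y) / (x' - x)) => m'; rewrite affpt_sline.
    rewrite -[RHS](inj_eq (mulIf Qv)) divfK // -[RHS]subr_eq0 -subr_eq0 -oppr_eq0.
    by congr (_ == _); ring.
  - by exists m => m'; rewrite infpt_sline eq_sym.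
  - by rewrite pt001_vline in Qv.
(* After exchanging the sums, it remains to see that on a line of slope m, lying off the vertical
   line means being different from P. *)
rewrite (exchange_big_dep xpredT) //=; apply: eq_bigr => m _.
have Pm : affpt x y \in A :&: points_on (sline m (y - m * x)).
  by rewrite !inE PA affpt_sline addrC subrK /=.
rewrite sum1dep_card [in RHS](cardsD1 (affpt x y)) Pm /=.
apply: eq_card => Q; rewrite !inE.
have [Qm|] := boolP (incident Q (sline m (y - m * x))); last by rewrite !andbF.
rewrite !andbT andbC [RHS]andbC; congr andb.
have [->|QP] := eqVneq Q (affpt x y); first by rewrite affpt_vline eqxx.
apply/negP => Qv; have Pm' : incident (affpt x y) (sline m (y - m * x)).
  by move: Pm; rewrite !inE => /andP[].
have := line_eq QP Qm Pm' Qv; rewrite affpt_vline eqxx => /(_ isT) e.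
by have := pt001_vline x; rewrite -e pt001_sline.
Qed.

Lemma card_vline A x : pt001 F \notin A ->
  #|A :&: points_on (vline x)| = #|[set y | affpt x y \in A]|.
Proof.
move=> NA; rewrite -(card_imset _ (fun y y' e => (@affpt_inj x y x y' e).2)).
apply: eq_card => Q; rewrite !inE; apply/andP/imsetP => [[QA Qv]|[y]]; last first.
  by rewrite inE => yA ->; rewrite affpt_vline.
have [[x' [y' e]]|[m e]|e] := point_cases Q; subst Q.
- by move: Qv; rewrite affpt_vline => /eqP xx; subst x'; exists y'; rewrite ?inE.
- by rewrite infpt_vline in Qv.
- by rewrite QA in NA.
Qed.

Lemma KM_arc_line_gt1 t A l P : (1 < t)%N -> KM_arc t A -> P \in A ->
  incident P l -> (1 < #|A :&: points_on l|)%N.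
Proof.
move=> t2 [_ /(_ l) sec _ _ _] PA Pl.
have : (0 < #|A :&: points_on l|)%N by apply/card_gt0P; exists P; rewrite !inE PA.
by case/or3P: sec => /eqP -> //.
Qed.

(** None of the q lines with a slope through the point contains the nucleus, so each is a 2-secant
    and carries one further point. Of the q + t points, t remain for the vertical line. *)
Lemma nucleus_vline_secant t B x y : (2 < t)%N -> KM_arc t B ->
  nucleus t B (pt001 F) -> affpt x y \in B -> secant t B (vline x).
Proof.
move=> t2 KM nuc PB; have [cB sec _ _ _] := KM.
have := card_pencil PB; rewrite cB (eq_bigr (fun=> 1%N)) => [|m _].
  by rewrite sum1_card /secant addnC => /addIn <-.
have Pm : incident (affpt x y) (sline m (y - m * x)).
  by rewrite affpt_sline addrC subrK.
have := KM_arc_line_gt1 (ltnW t2) KM PB Pm.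
have /or3P[/eqP->|/eqP->|st] // := sec (sline m (y - m * x)).
by have := nuc _ st; rewrite pt001_sline.
Qed.

(** If the nucleus were in [B], every vertical line would carry t - 1 other points and X = 0 at
    least two points in all. This gives q + t >= 2 + q (t - 1), impossible for t > 2 and q > 1. *)
Lemma nucleus_notin t B : (2 < t)%N -> KM_arc t B -> nucleus t B (pt001 F) ->
  pt001 F \notin B.
Proof.
move=> t2 KM nuc; apply/negP => NB; have q1 := card_finNzRing_gt1 F.
have [cB _ _ _ _] := KM.
have cX := KM_arc_line_gt1 (ltnW t2) KM NB pt001_lineX0.
(* The vertical line contains the nucleus, so it is no 0-secant; its second point of [B] must be
   affine, which makes it a t-secant. *)
have cv x : (#|B :&: points_on (vline x) :\ pt001 F| = t.-1)%N.
  have := KM_arc_line_gt1 (ltnW t2) KM NB (pt001_vline x).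
  rewrite (cardsD1 (pt001 F)) !inE NB pt001_vline /= ltnS => /card_gt0P[Q].
  rewrite !inE => /and3P[QN QB Qv].
  have [[x' [y' e]]|[m e]|e] := point_cases Q; subst Q.
  - move: Qv; rewrite affpt_vline => /eqP xx; subst x'.
    have /eqP := nucleus_vline_secant t2 KM nuc QB.
    by rewrite (cardsD1 (pt001 F)) !inE NB pt001_vline /= => <-.
  - by rewrite infpt_vline in Qv.
  - by rewrite eqxx in QN.
have : (#|B| = #|B :&: points_on (lineX0 F)|
    + \sum_x #|B :&: points_on (vline x) :\ pt001 F|)%N.
  rewrite -(cardsID (points_on (lineX0 F)) B); congr addn.
  transitivity (\sum_(Q in B :\: points_on (lineX0 F))
      \sum_(x | incident Q (vline x)) 1)%N.
    rewrite -sum1_card; apply: eq_bigr => Q; rewrite !inE => /andP[QX QB].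
    have [[x [y e]]|[m e]|e] := point_cases Q; subst Q.
    - rewrite (eq_bigl (pred1 x)) ?big_pred1_eq // => x'.
      by rewrite affpt_vline eq_sym.
    - by rewrite infpt_lineX0 in QX.
    - by rewrite pt001_lineX0 in QX.
  rewrite (exchange_big_dep xpredT) //=; apply: eq_bigr => x _.
  rewrite sum1dep_card; apply: eq_card => Q; rewrite !inE.
  have [[x' [y e]]|[m e]|e] := point_cases Q; subst Q.
  - rewrite affpt_lineX0 /=; case: eqP => // e.
    by have := affpt_lineX0 x' y; rewrite e pt001_lineX0.
  - by rewrite infpt_vline !andbF.
  - by rewrite pt001_lineX0 eqxx.
rewrite (eq_bigr (fun=> t.-1)) => [|x _]; last exact: cv.
rewrite sum_nat_const cB -/#|F| => e; have : (2 * t.-1 <= #|F| * t.-1)%N.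
  by rewrite leq_mul2r q1 orbT.
by nia.
Qed.

(** * Elations with axis X = 0 as vertical translations *)

(** Vertical lines are stable, so only y changes. The line joining two affine points with different
    x meets the axis in a fixed point, hence keeps its slope, and both points move by the same
    amount. *)
Lemma elation_translation phi : elation (lineX0 F) (pt001 F) phi ->
  exists c, forall x y, phi (affpt x y) = affpt x (y + c).
Proof.
case=> col _ fix_axis stab.
have image x y : exists y', phi (affpt x y) == affpt x y'.
  have : phi (affpt x y) \in phi @: points_on (vline x).
    by rewrite imset_f // inE affpt_vline.
  rewrite stab ?pt001_vline // inE.
  have [[x' [y' e]]|[m e]|e] := point_cases (phi (affpt x y)); rewrite e.
  - by rewrite affpt_vline => /eqP->; exists y'.
  - by rewrite infpt_vline.
  - move: e; rewrite -{1}(fix_axis _ pt001_lineX0) => /perm_inj e.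
    by have := affpt_lineX0 x y; rewrite e pt001_lineX0.
pose f x y := xchoose (image x y).
have fE x y : phi (affpt x y) = affpt x (f x y).
  exact/eqP/(xchooseP (image x y)).
have move_by x0 y0 x y : x != x0 -> f x y = y + (f x0 y0 - y0).
  move=> xx0; have {}xx0 : x - x0 != 0 by rewrite subr_eq0.
  pose m := (y - y0) / (x - x0).
  have [n nE] := col (sline m (y0 - m * x0)).
  have sub P : incident P (sline m (y0 - m * x0)) -> incident (phi P) n.
    move=> Pm; have : phi P \in points_on n by rewrite -nE imset_f // inE.
    by rewrite inE.
  have n0 : incident (affpt x0 (f x0 y0)) n.
    by rewrite -fE sub // affpt_sline addrC subrK.
  have nm : incident (infpt m) n.
    by rewrite -(fix_axis _ (infpt_lineX0 m)) sub // infpt_sline.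
  have nxy : incident (affpt x (f x y)) n.
    rewrite -fE sub // affpt_sline; apply/eqP; rewrite /m.
    by field.
  move: nxy; have [e|[m' e]] := line_affpt_cases n0; rewrite e in nm *.
    by rewrite infpt_vline in nm.
  move: nm; rewrite infpt_sline => /eqP mm; rewrite -mm affpt_sline => /eqP->.
  by rewrite /m; field.
exists (f 0 0) => x y; rewrite fE; congr (affpt x _).
(* Points on the vertical line of the origin cannot be compared with it directly; the comparison
   passes through (1, 1, 0). *)
have [->|x0] := eqVneq x 0; last by rewrite (move_by 0 0) // subr0.
rewrite (move_by 1 0) ?subr0; last by rewrite eq_sym oner_eq0.
by rewrite (move_by 0 0) ?oner_eq0 // subr0 add0r.
Qed.

(** The centre in [elation_KM_arc] is arbitrary on the axis. Were it [infpt m], the line of slope m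
    through the point would be stable, and it meets the vertical line only in that point. *)
Lemma elation_centre R phi x y y' : elation (lineX0 F) R phi ->
  phi (affpt x y) = affpt x y' -> y != y' -> R = pt001 F.
Proof.
case=> _ RX _ stab phiP yy'.
have [[x' [y0 e]]|[m e]|//] := point_cases R; subst R.
  by rewrite affpt_lineX0 in RX.
have Pm : incident (affpt x y) (sline m (y - m * x)).
  by rewrite affpt_sline addrC subrK.
have : phi (affpt x y) \in phi @: points_on (sline m (y - m * x)).
  by rewrite imset_f // inE.
rewrite stab ?infpt_sline // phiP inE affpt_sline addrC subrK => /eqP e.
by rewrite e eqxx in yy'.
Qed.

(** * Construction of the elations that realise all vertical translations *)

(** The linear map (X, Y, Z) -> (X, Y, Z + c X), which on affine points is y -> y + c. *)
Definition shear c (v : 'rV[F]_3) : 'rV[F]_3 := v + (c * v 0 0) *: hvec 0 0 1.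

Lemma shear_linear c : linear (shear c).
Proof.
move=> k u v; rewrite /shear !mxE scalerDr scalerA addrACA -scalerDl.
by congr (_ + _ *: _); ring.
Qed.

HB.instance Definition _ c :=
  GRing.isLinear.Build F 'rV[F]_3 'rV[F]_3 _ (shear c) (shear_linear c).

Lemma shearK c : cancel (shear c) (shear (- c)).
Proof.
move=> v; rewrite /shear !mxE /= mulr0 addr0 -addrA -scalerDl mulNr subrr.
by rewrite scale0r addr0.
Qed.

Lemma shear_hvec c x y : shear c (hvec 1 x y) = hvec 1 x (y + c).
Proof.
apply/rowP; case=> [[|[|[|//]]] lt]; rewrite !mxE /= !mulr1 ?mulr0 ?addr0 //.
Qed.

Lemma dim_shear c (U : {vspace 'rV[F]_3}) :
  \dim (linfun (shear c) @: U) = \dim U.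
Proof.
apply: limg_dim_eq; suff /eqP -> : lker (linfun (shear c)) == 0%VS by rewrite capv0.
by apply/lker0P; apply: (can_inj (g := shear (- c))) => v; rewrite lfunE /= shearK.
Qed.

Lemma shearK_vspace c (U : {vspace 'rV[F]_3}) :
  (linfun (shear (- c)) @: (linfun (shear c) @: U))%VS = U.
Proof.
rewrite -limg_comp (_ : (_ \o _)%VF = \1%VF) ?lim1g //.
by apply/lfunP => v; rewrite comp_lfunE !lfunE /= shearK.
Qed.

Lemma dim_shear_eq c d (U : {vspace 'rV[F]_3}) :
  \dim U == d -> \dim (linfun (shear c) @: U) == d.
Proof. by rewrite dim_shear. Qed.

Definition shear_point c P : point F :=
  exist _ (linfun (shear c) @: val P)%VS (dim_shear_eq c (valP P)).

Definition shear_line c l : line F :=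
  exist _ (linfun (shear c) @: val l)%VS (dim_shear_eq c (valP l)).

Lemma shear_pointK c : cancel (shear_point c) (shear_point (- c)).
Proof. by move=> P; apply: val_inj; exact: shearK_vspace. Qed.

Lemma incident_shear c P l :
  incident (shear_point c P) (shear_line c l) = incident P l.
Proof.
apply/idP/idP; last exact: limgS.
by move/(limgS (linfun (shear (- c)))); rewrite /= !shearK_vspace.
Qed.

Definition shear_perm c : {perm point F} := perm (can_inj (shear_pointK c)).

Lemma shear_perm_affpt c x y : shear_perm c (affpt x y) = affpt x (y + c).
Proof.
rewrite permE; apply/hpoint_eq => /=; apply/memv_imgP.
by exists (hvec 1 x y); rewrite ?memv_line // lfunE /= shear_hvec.
Qed.

Lemma shear_perm_fix c P : incident P (lineX0 F) -> shear_perm c P = P.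
Proof.
move=> PX; rewrite permE; apply/val_inj/eqP; rewrite eqEdim dim_shear leqnn andbT.
apply/subvP => _ /memv_imgP[v vP ->]; rewrite lfunE /= /shear.
by have := subvP PX _ vP; rewrite mem_lineX0 => /eqP->; rewrite mulr0 scale0r addr0.
Qed.

Lemma imset_shear c l :
  shear_perm c @: points_on l = points_on (shear_line c l).
Proof.
apply/setP => Q; rewrite inE; apply/imsetP/idP => [[P]|Ql].
  by rewrite inE => Pl ->; rewrite permE incident_shear.
exists (shear_point (- c) Q); last first.
  by rewrite permE -{1}(opprK c) shear_pointK.
by rewrite inE -(incident_shear c) -{1}(opprK c) shear_pointK.
Qed.

(** A shear moves each vector by a multiple of (0,0,1), so it stabilises every line through that
    point; the multiple vanishes where X = 0. *)
Lemma shear_elation c : elation (lineX0 F) (pt001 F) (shear_perm c).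
Proof.
split; [by move=> l; exists (shear_line c l); exact: imset_shear
  | exact: pt001_lineX0 | exact: shear_perm_fix |].
move=> l Nl; rewrite imset_shear; congr points_on; apply/val_inj/eqP.
rewrite eqEdim dim_shear leqnn andbT; apply/subvP => _ /memv_imgP[v vl ->].
by rewrite lfunE /= memvD // memvZ // memvE.
Qed.

End Plane.

(** * Lifting an arc to the extension field through a direct complement *)

Section FieldExtension.
Variables (F L : finFieldType) (iota : {rmorphism F -> L}) (I : {set L}).
Hypothesis compl : direct_complement iota I.
Implicit Types (H : {set point F}) (A : {set point L}).

Let subI z z' : z \in I -> z' \in I -> z - z' \in I.
Proof. by case: compl => -[_ subI] _ _; exact: subI. Qed.

Let addI z z' : z \in I -> z' \in I -> z + z' \in I.
Proof.
move=> zI z'I; rewrite -[z']opprK subI // -sub0r subI //.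
by case: compl => -[].
Qed.

Lemma direct_complement_unique y i y' i' : i \in I -> i' \in I ->
  iota y + i = iota y' + i' -> y = y' /\ i = i'.
Proof.
move=> iI i'I e; have dE : iota (y - y') = i' - i.
  by rewrite rmorphB; apply: (addIr (iota y' + i)); rewrite addrA subrK e; ring.
have d0 : iota (y - y') = 0.
  by case: compl => _ meet0 _; apply: meet0; rewrite dE subI.
have yy' : y = y'.
  by apply/eqP; rewrite -subr_eq0 -(fmorph_eq0 iota) d0.
by split=> //; apply: (addrI (iota y)); rewrite e yy'.
Qed.

(** Directness makes (y, i) -> [iota y + i] injective. Taking all of [F] for S gives the size of
    [I]; taking a vertical section of [H] gives that of [J]. *)
Lemma card_cosets (S : {set F}) :
  #|[set iota p.1 + p.2 | p in setX S I]| = (#|S| * #|I|)%N.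
Proof.
rewrite card_in_imset ?cardsX // => -[y i] [y' i'].
rewrite !inE /= => /andP[_ iI] /andP[_ i'I].
by case/(direct_complement_unique iI i'I) => -> ->.
Qed.

Lemma card_direct_complement h : (0 < h)%N -> #|L| = (#|F| ^ h)%N ->
  #|I| = (#|F| ^ h.-1)%N.
Proof.
move=> h0 cL; have F0 : (0 < #|F|)%N by apply/card_gt0P; exists 0.
apply/eqP; rewrite -(eqn_pmul2l F0) -expnS prednK // -cL -[#|F|]cardsT.
rewrite -card_cosets -cardsT; apply/eqP/esym/eq_card => z; rewrite inE.
have [a [i iI ->]] : exists a, exists2 i, i \in I & z = iota a + i.
  by case: compl => _ _; apply.
by apply/esym/imsetP; exists (a, i); rewrite ?inE.
Qed.

Lemma affpt_JsetP H u v : reflect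
  (exists x y i, [/\ affpt x y \in H, i \in I, u = iota x & v = iota y + i])
  (affpt u v \in Jset iota I H).
Proof.
rewrite inE; apply: (iffP idP).
  move=> /existsP[x] /existsP[y] /existsP[i] /and3P[yH iI /eqP e].
  by have [-> ->] := affpt_inj e; exists x, y, i.
case=> x [y [i [yH iI -> ->]]]; apply/existsP; exists x; apply/existsP; exists y.
by apply/existsP; exists i; rewrite yH iI eqxx.
Qed.

Lemma extendsX0_affpt H A u v : extendsX0 (Jset iota I H) A ->
  (affpt u v \in A) = (affpt u v \in Jset iota I H).
Proof.
case=> JA AJ; apply/idP/idP => [PA|/(subsetP JA)//].
apply/negPn/negP => PJ; have : affpt u v \in A :\: Jset iota I H.
  by rewrite inE PJ.
by move/(subsetP AJ); rewrite inE affpt_lineX0.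
Qed.

(** Common core of both constructions, with t = 2 allowed: of [H] only the size of its vertical
    sections and its invariance under vertical differences are retained. *)
Lemma elation_arc_extension H A h t :
  (1 < h)%N -> (1 < t)%N -> #|L| = (#|F| ^ h)%N ->
  (forall x y, affpt x y \in H -> #|[set y' | affpt x y' \in H]| = t) ->
  (forall x y y', affpt x y \in H -> affpt x y' \in H ->
     forall a b, affpt a b \in H -> affpt a (b + (y' - y)) \in H) ->
  KM_arc (t * #|F| ^ h.-1)%N A -> extendsX0 (Jset iota I H) A ->
  elation_KM_arc (t * #|F| ^ h.-1)%N A (lineX0 L) /\
  nucleus (t * #|F| ^ h.-1)%N A (pt001 L).
Proof.
move=> h1 t1 cL sections inv_trans; set T := (t * _)%N => KM ext.
have [cA sec _ _ _] := KM.
have F1 : (1 < #|F|)%N := card_finNzRing_gt1 F.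
(* As h > 1, the factor q^(h-1) is at least 2, so T >= 4 even for t = 2. *)
have T2 : (2 < T)%N.
  have : (1 < #|F| ^ h.-1)%N by rewrite -{1}(expn0 #|F|) ltn_exp2l //; lia.
  by rewrite /T; nia.
have cI := card_direct_complement (ltnW h1) cL.
(* Over u = [iota x] the section is [iota] S + [I], with S the section of [H] over x. *)
have aff_section u v : affpt u v \in A -> #|[set w | affpt u w \in A]| = T.
  rewrite (extendsX0_affpt _ _ ext) => /affpt_JsetP[x [y [i [yH iI -> _]]]].
  rewrite /T -(sections x y yH) -cI -card_cosets; apply: eq_card => w.
  rewrite inE (extendsX0_affpt _ _ ext).
  apply/affpt_JsetP/imsetP => [[x' [y' [i' [y'H i'I e ->]]]]|[[y' i']]].
    by exists (y', i'); rewrite // !inE /= i'I (fmorph_inj iota e) y'H.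
  by rewrite !inE /= => /andP[y'H i'I] ->; exists x, y', i'.
(* Otherwise a vertical line would carry T affine points and (0,0,1), more than any secant may. *)
have N_A u v : affpt u v \in A -> pt001 L \notin A.
  move=> PA; apply/negP => NA; have := sec (vline u).
  have le : (T < #|A :&: points_on (vline u)|)%N.
    rewrite (cardsD1 (pt001 L)) !inE NA pt001_vline /= add1n ltnS.
    rewrite -(aff_section _ _ PA).
    rewrite -(card_imset _ (fun w w' e => (@affpt_inj _ u w u w' e).2)).
    apply/subset_leq_card/subsetP => _ /imsetP[w wA ->]; move: wA; rewrite !inE.
    move=> ->; rewrite affpt_vline eqxx /= andbT; apply/eqP => e.
    by have := affpt_lineX0 u w; rewrite e pt001_lineX0.
  by rewrite /secant; case/or3P => /eqP e; move: le; rewrite e; lia.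
have vsec u v : affpt u v \in A -> secant T A (vline u).
  by move=> PA; rewrite /secant (card_vline _ (N_A _ _ PA)) (aff_section _ _ PA).
(* The vertical line takes T points, leaving #|L| points for #|L| lines with a slope, each needing
   at least one. A T-secant among them would take T - 1 > 1. *)
have secant_vertical u v l : affpt u v \in A -> secant T A l ->
    incident (affpt u v) l -> l = vline u.
  move=> PA lT Pl; have [//|[m e]] := line_affpt_cases Pl.
  have := card_pencil PA; rewrite cA (eqP (vsec _ _ PA)) (bigD1 m) //= -e (eqP lT).
  set S := bigop _ _ _; have : (\sum_(m' : L | m' != m) 1 <= S)%N.
    apply: leq_sum => m' _; rewrite -ltnS prednK.
      apply: KM_arc_line_gt1 (ltnW T2) KM PA _.
      by rewrite affpt_sline addrC subrK.
    by apply/card_gt0P; exists (affpt u v); rewrite !inE PA affpt_sline addrC subrK /=.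
  rewrite sum1_card (cardC1 m); have L1 := card_finNzRing_gt1 L.
  by move: #|L| L1 => n; clearbody S; lia.
(* A T-secant without affine points of [A] has two points of [A] on X = 0, hence equals that
   line. *)
have secant_cases l : secant T A l ->
    l = lineX0 L \/ exists u v, affpt u v \in A /\ l = vline u.
  move=> lT.
  have [/existsP[u /existsP[v /andP[PA Pl]]]|none] :=
      boolP [exists u, exists v, (affpt u v \in A) && incident (affpt u v) l].
    by right; exists u, v; split; last exact: secant_vertical Pl.
  left; have onX P : P \in A :&: points_on l -> incident P (lineX0 L).
    rewrite !inE => /andP[PA Pl]; have [[u [v e]]|[m ->]|->] := point_cases P.
    - case/existsP: none; exists u; apply/existsP; exists v.
      by rewrite -e PA.
    - exact: infpt_lineX0.
    - exact: pt001_lineX0.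
  have : (1 < #|A :&: points_on l|)%N by rewrite (eqP lT) ltnW.
  case/card_gt1P => P [Q [Pl Ql PQ]]; apply: (line_eq PQ) (onX _ Pl) (onX _ Ql).
    by move: Pl; rewrite !inE => /andP[].
  by move: Ql; rewrite !inE => /andP[].
split; last first.
  move=> l /secant_cases[->|[u [v [_ ->]]]]; first exact: pt001_lineX0.
  exact: pt001_vline.
split=> // l lT lX P Q.
have [e|[u [v [uvA e]]]] := secant_cases l lT; first by rewrite e eqxx in lX.
subst l; have on_vline R : R \in A :&: points_on (vline u) ->
    exists w, R = affpt u w.
  rewrite !inE => /andP[RA Rv]; have [[u' [w e]]|[m e]|e] := point_cases R; subst R.
  - by move: Rv; rewrite affpt_vline => /eqP->; exists w.
  - by rewrite infpt_vline in Rv.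
  - by move: (N_A _ _ uvA); rewrite RA.
move=> Pl Ql; have [p e] := on_vline P Pl; have [r e'] := on_vline Q Ql; subst P Q.
move: Pl Ql; rewrite !inE !affpt_vline !eqxx !andbT !(extendsX0_affpt _ _ ext).
move=> /affpt_JsetP[x [y [i [yH iI ux ->]]]].
move=> /affpt_JsetP[x' [y' [i' [y'H i'I ux' ->]]]].
(* The two points share their x, so the vertical translation by d takes one to the other. *)
have xx' : x' = x by apply: (fmorph_inj iota); rewrite -ux -ux'.
subst x'; set d := iota (y' - y) + (i' - i).
exists (shear_perm d); split.
- by exists (pt001 L); exact: shear_elation.
(* A permutation preserves cardinality, so one inclusion suffices. *)
- apply/eqP; rewrite /stabilises eqEcard card_imset; last exact: perm_inj.
  rewrite leqnn andbT; apply/subsetP => _ /imsetP[R RA ->].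
  have [[a [b e]]|[m e]|e] := point_cases R; subst R.
  + move: RA; rewrite shear_perm_affpt !(extendsX0_affpt _ _ ext).
    move=> /affpt_JsetP[a' [b' [j [b'H jI -> ->]]]]; apply/affpt_JsetP.
    (* The translation splits along the direct sum: y' - y acts within [H], and i' - i within
       [I]. *)
    exists a', (b' + (y' - y)), (j + (i' - i)).
    split=> //; first exact: inv_trans y'H _ _ b'H.
      by rewrite addI // subI.
    by rewrite rmorphD addrACA.
  + by rewrite shear_perm_fix // infpt_lineX0.
  + by rewrite shear_perm_fix // pt001_lineX0.
- by rewrite shear_perm_affpt /d rmorphB; congr (affpt u _); ring.
Qed.

End FieldExtension.

(** * Sections and translations of the two kinds of starting arc *)

Section Sources.
Variable F : finFieldType.
Implicit Types H B : {set point F}.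

Lemma KM_arc_sections t B : (2 < t)%N -> KM_arc t B ->
  nucleus t B (pt001 F) ->
  forall x y, affpt x y \in B -> #|[set y' | affpt x y' \in B]| = t.
Proof.
move=> t2 KM nuc x y PB.
rewrite -card_vline ?(nucleus_notin t2 KM nuc) //.
exact/eqP/(nucleus_vline_secant t2 KM nuc PB).
Qed.

(** The vertical line is a t-secant, so some elation preserving [B] takes one point to the other.
    Moving a point vertically, it has centre (0,0,1) and is the translation by y' - y. *)
Lemma elation_KM_arc_translations t B : (2 < t)%N ->
  elation_KM_arc t B (lineX0 F) -> nucleus t B (pt001 F) ->
  forall x y y', affpt x y \in B -> affpt x y' \in B ->
  forall a b, affpt a b \in B -> affpt a (b + (y' - y)) \in B.
Proof.
move=> t2 [_ KM trans] nuc x y y' yB y'B a b bB.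
have [->|yy'] := eqVneq y y'; first by rewrite subrr addr0.
have vX : vline x != lineX0 F.
  by apply/eqP => e; have := affpt_lineX0 x y; rewrite -e affpt_vline eqxx.
have st := nucleus_vline_secant t2 KM nuc yB.
have on_vline z : affpt x z \in B -> affpt x z \in B :&: points_on (vline x).
  by move=> zB; rewrite !inE zB affpt_vline eqxx.
have [phi [[R el] stab phiP]] :=
  trans _ st vX _ _ (on_vline _ yB) (on_vline _ y'B).
have RN := elation_centre el phiP yy'; subst R.
have [c phiE] := elation_translation el.
have -> : y' - y = c.
  by move: phiP; rewrite phiE => /affpt_inj[_ <-]; rewrite addrAC subrr add0r.
by rewrite -phiE -stab imset_f.
Qed.

Lemma hyperoval_sections H : hyperoval H -> pt001 F \notin H ->
  forall x y, affpt x y \in H -> #|[set y' | affpt x y' \in H]| = 2%N.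
Proof.
move=> hyp NH x y PH; rewrite -card_vline //.
have := KM_arc_line_gt1 (isT : (1 < 2)%N) hyp PH.
move=> /(_ (vline x)); rewrite affpt_vline eqxx => /(_ isT).
by have [_ sec _ _ _] := hyp; case/or3P: (sec (vline x)) => /eqP->.
Qed.

(** The given elation is a translation by some c, and a vertical section has two points, so it is
    {y, y + c}. Hence y' - y is 0 or c. *)
Lemma hyperoval_translations H phi : hyperoval H -> pt001 F \notin H ->
  elation (lineX0 F) (pt001 F) phi -> phi <> 1%g -> stabilises phi H ->
  forall x y y', affpt x y \in H -> affpt x y' \in H ->
  forall a b, affpt a b \in H -> affpt a (b + (y' - y)) \in H.
Proof.
move=> hyp NH el phi1 stab x y y' yH y'H a b bH.
have [c phiE] := elation_translation el.
have translate u v : affpt u v \in H -> affpt u (v + c) \in H.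
  by move=> uvH; rewrite -phiE -stab imset_f.
(* With c = 0 the elation would fix all affine points as well as the axis. *)
have c0 : c != 0.
  apply/eqP => c0; apply: phi1; apply/permP => P; rewrite perm1.
  have [_ _ fix_axis _] := el; have [[u [v ->]]|[m ->]|->] := point_cases P.
  - by rewrite phiE c0 addr0.
  - exact/fix_axis/infpt_lineX0.
  - exact/fix_axis/pt001_lineX0.
have [->|yy'] := eqVneq y' y; first by rewrite subrr addr0.
suff -> : y' - y = c by exact: translate.
have : y' \in [set y; y + c].
  suff -> : [set y; y + c] = [set y' | affpt x y' \in H] by rewrite inE.
  apply/eqP; rewrite eqEcard (hyperoval_sections hyp NH yH) cards2.
  rewrite -[y in y != _]addr0 (inj_eq (addrI y)) eq_sym c0 andbT.
  by apply/subsetP => z; rewrite !inE => /orP[]/eqP-> //; exact: translate.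
by rewrite !inE (negPf yy') => /eqP->; rewrite addrAC subrr add0r.
Qed.

End Sources.

Theorem lemma2p4 (q e h : nat) (hq : q = (2 ^ e)%N) (hh : (1 < h)%N)
    (F L : finFieldType) (hF : #|F| = q) (hL : #|L| = (q ^ h)%N)
    (iota : {rmorphism F -> L}) :
  (forall (t : nat) (B : {set point F}) (A : {set point L}),
      (2 < t)%N ->
      elation_KM_arc t B (lineX0 F) ->
      nucleus t B (pt001 F) ->
      arises_by_C iota h t B A ->
      elation_KM_arc (t * q ^ h.-1) A (lineX0 L) /\
      nucleus (t * q ^ h.-1) A (pt001 L)) /\
  (forall (H : {set point F}) (A' : {set point L}),
      hyperoval H ->
      (exists phi : {perm point F},
          [/\ elation (lineX0 F) (pt001 F) phi, phi <> 1%g & stabilises phi H]) ->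
      arises_by_B iota h H A' ->
      elation_KM_arc (2 * q ^ h.-1) A' (lineX0 L) /\
      nucleus (2 * q ^ h.-1) A' (pt001 L)).
Proof.
split.
  move=> t B A t2 elB nuc [_ KM _ [I [compl KMA ext]]].
  rewrite -hF in hL *; apply: (elation_arc_extension compl hh (ltnW t2) hL _ _ KMA ext).
    exact: KM_arc_sections KM nuc.
  exact: elation_KM_arc_translations elB nuc.
move=> H A hyp [phi [el phi1 stab]] [_ NH [I [compl KMA ext]]].
rewrite -hF in hL *; apply: (elation_arc_extension compl hh _ hL _ _ KMA ext) => //.
  exact: hyperoval_sections.
exact: hyperoval_translations el phi1 stab.
Qed.
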